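(* Let $\lambda$ be an infinite cardinal and let $X$ be any topological space such that $\big((2^\lambda)^+,\lambda\big)$ is a pinning down pair for $X$. Then $\varrho(X) = |RO(X)| \le 2^\lambda$. Consequently, $d(X) \le \lambda$ if $RO^+(X)$ is a $\pi$-base of $X$.
   Context: No separation axioms are assumed. For cardinals $\kappa > \lambda \ge \omega$, $(\kappa,\lambda)$ is a pinning down pair for a topological space $X$ if for every family $\mathcal{U}$ of non-empty open sets in $X$ with $|\mathcal{U}| \le \kappa$ there is $B \subset X$ with $|B| \le \lambda$ such that $B \cap U \ne \emptyset$ for each $U \in \mathcal{U}$. $RO(X)$ is the family of all regular open sets of $X$, $RO^+(X) = RO(X) \setminus \{\emptyset\}$, and $\varrho(X) = |RO(X)|$. A $\pi$-base of $X$ is a family of non-empty open sets such that every non-empty open set of $X$ includes a member of the family. $d(X)$ is the density of $X$. *)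

(* Defs.v *)
From HB Require Import structures.
From mathcomp Require Import all_boot all_order.
From mathcomp Require Import boolp classical_sets functions cardinality topology.

Set Implicit Arguments.
Unset Strict Implicit.
Unset Printing Implicit Defensive.

Local Open Scope classical_set_scope.
Local Open Scope card_scope.

(* A cardinal is represented by any set of that cardinality, and cardinals are
   compared through [#<=], the existence of an injection; 2^lambda is
   [[set: set L]] when [[set: L]] represents lambda. *)

Definition card_lt (T U : Type) (A : set T) (B : set U) : Prop :=
  A #<= B /\ ~ (B #<= A).

(* |K| = |A|^+, the least cardinal greater than |A| *)
Definition is_succ_card (T U : Type) (K : set T) (A : set U) : Prop :=
  card_lt A K /\ forall (V : Type) (C : set V), card_lt A C -> K #<= C.

Lemma fun_card_le (T U : Type) (f : T -> U) :
  injective f -> [set: T] #<= [set: U].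
Proof.
move=> fI; rewrite -(card_le_eql (@inj_card_eq _ _ setT f _)); first exact: card_leT.
by move=> x y _ _ /fI.
Qed.

(* Any family of cardinals has a least element. Honig's argument: a maximal set
   of choice functions on which all the projections are injective projects onto
   some member of the family. *)
Lemma card_min (I : Type) (i0 : I) (T : I -> Type) :
  exists i, forall j, [set: T i] #<= [set: T j].
Proof.
pose P (S : set (forall i, T i)) :=
  forall i f g, S f -> S g -> f i = g i -> f = g.
have [F FP Ftot|S [PS Smax]] := @Zorn_bigcup _ P.
  move=> i f g [A FA Af] [B FB Bg]; have [AB|BA] := Ftot _ _ FA FB.
  - by apply: (FP _ FB) => //; exact: AB.
  - by apply: (FP _ FA) => //; exact: BA.
have [i Si] : exists i, forall a : T i, exists f, S f /\ f i = a.
  apply: contrapT => noi.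
  have noa i : exists a : T i, forall f, S f -> f i <> a.
    apply: contrapT => noa; apply: noi; exists i => a.
    apply: contrapT => nof; apply: noa; exists a => f Sf fia.
    by apply: nof; exists f.
  pose f i := sval (cid (noa i)); have fS i := svalP (cid (noa i)).
  apply: (Smax (S `|` [set f])); last first.
    move=> i g h [Sg|->] [Sh|->] // gh; first exact: (PS i).
    - by have := fS i g Sg gh.
    - by have := fS i h Sh (esym gh).
  split=> [g Sg|/(_ f (or_intror erefl)) Sf]; first by left.
  exact: fS i0 _ Sf erefl.
have [h hS] := choice Si.
exists i => j; apply: (@fun_card_le _ _ (fun a => h a j)) => a b ab.
have [[Sa <-] [Sb <-]] := (hS a, hS b).
by rewrite (PS j _ _ Sa Sb ab).
Qed.

Lemma card_le_total (T U : Type) (A : set T) (B : set U) : A #<= B \/ B #<= A.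
Proof.
have [[] h] := @card_min bool true (fun b => if b then set_type A else set_type B).
- left; have := h false.
  by rewrite (card_le_eql (card_setT A)) (card_le_eqr (card_setT B)).
- right; have := h true.
  by rewrite (card_le_eql (card_setT B)) (card_le_eqr (card_setT A)).
Qed.

Lemma min_card_set (T : Type) (F : set (set T)) :
  F !=set0 -> exists2 A, F A & forall B, F B -> A #<= B.
Proof.
move=> [A0 FA0]; pose I := {A : set T | F A}.
have [[A FA] h] := @card_min I (exist _ A0 FA0) (fun i => sval i).
exists A => // B FB; have := h (exist _ B FB).
by rewrite (card_le_eql (card_setT A)) (card_le_eqr (card_setT B)).
Qed.

Lemma card_set_nle (T : Type) : ~ ([set: set T] #<= [set: T]).
Proof.
move=> /card_leP[f]; pose g A := val (f (to_setT A)).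
have gI : injective g.
  by move=> A B /val_inj /(inj (in_setT _) (in_setT _)) /(congr1 val).
pose D : set T := [set a | exists2 A, g A = a & ~ A a].
have nD : ~ D (g D) by move=> DD; case: (DD) => A /gI -> /(_ DD).
by apply: (nD); exists D.
Qed.

Lemma succ_card_exists (U : Type) (A : set U) :
  exists K : set (set A), is_succ_card K A.
Proof.
have [|K nKA Kmin] := @min_card_set _ [set K : set (set A) | ~ (K #<= A)].
  exists setT; rewrite /= (card_le_eqr (card_setT_sym A)); exact: card_set_nle.
exists K; split=> [|V C [_ nCA]].
  by split=> //; have [] := card_le_total A K.
have [//|CK] := card_le_total K C.
have [f] := card_leP CK; pose g a := val (f a).
have CE : range g #= C.
  apply: card_eq_trans (card_setT C); apply: inj_card_eq => a b _ _.
  by move=> /val_inj /(inj (in_setT _) (in_setT _)).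
by rewrite -(card_le_eqr CE); apply: Kmin; rewrite /= (card_le_eql CE).
Qed.

Section PinningDown.
Context (X : topologicalType).
Implicit Types (UU : set (set X)) (B D : set X).

(* kappa = |K| and lambda = |L|; the standing requirement kappa > lambda >= omega
   is not part of the definition. *)
Definition pinning_down_pair (S T : Type) (K : set S) (L : set T) : Prop :=
  forall UU, (forall U, UU U -> open U /\ U !=set0) -> UU #<= K ->
    exists B, B #<= L /\ forall U, UU U -> B `&` U !=set0.

Definition RO : set (set X) := [set U | regopen U].

Definition ROplus : set (set X) := RO `\ set0.

Definition pi_base UU : Prop :=
  (forall U, UU U -> open U /\ U !=set0) /\
  (forall V, open V -> V !=set0 -> exists2 U, UU U & U `<=` V).

Definition least_dense D : Prop :=
  dense D /\ forall E : set X, dense E -> D #<= E.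

(* d(X), represented by a dense set of least cardinality; the default value is
   irrelevant by [densityP] *)
Definition density : set X := xget setT least_dense.

Lemma densityP : least_dense density.
Proof.
rewrite /density; apply: xgetPex.
have [|D dD Dmin] := @min_card_set _ [set D : set X | dense D].
  by exists setT => O O0 _; rewrite setIT.
by exists D.
Qed.

End PinningDown.

Arguments RO : clear implicits.
Arguments ROplus : clear implicits.
Arguments density : clear implicits.

(* Main.v *)
Require Import Defs.
From HB Require Import structures.
From mathcomp Require Import all_boot all_order.
From mathcomp Require Import boolp classical_sets functions cardinality topology.
Local Open Scope classical_set_scope.
Local Open Scope card_scope.

(** If [U] and [V] are distinct regular open sets, then [U `\` closure V] or
    [V `\` closure U] is a non-empty open set.  Hence a set [B] that meets all
    the non-empty differences [U `\` closure V], for [U], [V] in a family of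
    regular open sets, separates the members of that family by their traces on
    [B].  A family of size kappa = (2^lambda)^+ has only that many differences,
    since kappa * kappa = kappa, so a pinning set of size lambda would yield
    (2^lambda)^+ distinct traces on it, which is absurd. *)

(** * Cardinal inequalities as injective functions *)

Lemma card_leTP (T U : Type) (B : set U) :
  [set: T] #<= B <-> exists2 f : T -> U, injective f & forall x, B (f x).
Proof.
split=> [/card_leP[f]|[f fI fB]].
  exists (fun x => val (f (to_setT x))) => [x y|x]; last exact: set_valP.
  by move=> /val_inj /(inj (in_setT _) (in_setT _)) /(congr1 val).
have fT : [set: T] #<= range f.
  by rewrite -(card_le_eql (@inj_card_eq _ _ setT f _)) // => x y _ _ /fI.
by apply: card_le_trans fT (subset_card_le _) => _ [x _ <-].
Qed.

Lemma card_lePT (T U : Type) (A : set T) :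
  A #<= [set: U] <-> exists f : set_type A -> U, injective f.
Proof.
rewrite -(card_le_eql (card_setT A)); split=> [/card_leTP[f fI _]|[f fI]].
  by exists f.
by apply/card_leTP; exists f.
Qed.

(** Making the injection total, with default value [u0] off [A], avoids subtypes in later
    constructions. *)
Lemma card_le_fun (T U : Type) (u0 : U) (A : set T) (B : set U) : A #<= B ->
  exists2 f : T -> U, (forall x y, A x -> A y -> f x = f y -> x = y) &
    forall x, A x -> B (f x).
Proof.
rewrite -(card_le_eql (card_setT A)) => /card_leTP[f fI fB].
exists (fun x =>
    if pselect (A x) is left Ax then f (SigSub (mem_set Ax)) else u0).
  by move=> x y Ax Ay; do 2![case: pselect => // ?] => /fI[].
by move=> x Ax; case: pselect.
Qed.

(** * Pairing functions on infinite sets *)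

Section Square.
Context (A : Type).

(* Two distinct elements suffice to label the two halves of a disjoint union. *)
Definition square_inj (B : set A) (f : A -> A -> A) : Prop :=
  [/\ exists e0 e1, [/\ B e0, B e1 & e0 <> e1],
      forall a b, B a -> B b -> B (f a b) &
      forall a b c d, B a -> B b -> B c -> B d -> f a b = f c d ->
        a = c /\ b = d].

(** The range of an injection of the naturals inherits a pairing function from [nat]. *)
Lemma square_inj_exists : infinite_set [set: A] -> exists B f, square_inj B f.
Proof.
move=> /infiniteP /card_leTP[n nI _].
pose m a := xget 0%N [set i | n i = a].
have nK i : m (n i) = i by apply: nI; rewrite /m; case: xgetP => [_ -> //|/(_ i)[]].
exists (range n), (fun a b => n (choice.pickle (m a, m b))); split.
- by exists (n 0%N), (n 1%N); split=> [||/nI//]; [exists 0%N|exists 1%N].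
- by move=> a b _ _; exists (choice.pickle (m a, m b)).
- move=> _ _ _ _ [a _ <-] [b _ <-] [c _ <-] [d _ <-].
  by rewrite !nK => /nI /(pcan_inj choice.pickleK)[-> ->].
Qed.

(** Zorn's lemma for pairing functions under extension. Values off the domain are ignored, so the
    relation is only a preorder. *)
Lemma square_inj_maximal : infinite_set [set: A] ->
  exists B f, square_inj B f /\ forall C g, square_inj C g ->
    B `<=` C -> (forall a b, B a -> B b -> f a b = g a b) -> C `<=` B.
Proof.
move=> /square_inj_exists[B0 [f0 sq0]].
pose T := {p : set A * (A -> A -> A) | square_inj p.1 p.2}.
pose R (s t : T) := `[< (sval s).1 `<=` (sval t).1 /\ forall a b,
  (sval s).1 a -> (sval s).1 b -> (sval s).2 a b = (sval t).2 a b >].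
have [|||[[B f] sq] Bmax] := @ZL_preorder T (exist _ (B0, f0) sq0) R.
- by move=> t; apply/asboolP; split.
- move=> r s t /asboolP[rs rsf] /asboolP[st stf]; apply/asboolP; split.
    exact: subset_trans st.
  by move=> a b ra rb; rewrite rsf// stf//; exact: rs.
- move=> F Ftot; have [[t0 Ft0]|F0] := pselect (exists t, F t); last first.
    by exists (exist _ (B0, f0) sq0) => s Fs; case: F0; exists s.
  pose C := [set a | exists2 t, F t & (sval t).1 a].
  pose P a b := [set t | [/\ F t, (sval t).1 a & (sval t).1 b]].
  (* The union of the chain: any member whose domain contains [a] and [b] may give the value, and
     [gE] shows that the choice is irrelevant. *)
  pose g a b := if pselect (exists t, P a b t) is left e
    then (sval (sval (cid e))).2 a b else a.
  have two s t : F s -> F t -> exists u, [/\ F u, R s u & R t u].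
    move=> Fs Ft; have [st|ts] := Ftot _ _ Fs Ft.
      by exists t; split=> //; apply/asboolP; split.
    by exists s; split=> //; apply/asboolP; split.
  have gE t a b : F t -> (sval t).1 a -> (sval t).1 b -> g a b = (sval t).2 a b.
    move=> Ft ta tb.
    rewrite /g; case: pselect => [e|[]]; last by exists t.
    case: (cid e) => s [Fs sa sb] /=.
    have [u [_ /asboolP[_ su] /asboolP[_ tu]]] := two _ _ Fs Ft.
    by rewrite su// tu.
  have pair a b : C a -> C b -> exists t, P a b t.
    move=> [s Fs sa] [t Ft tb].
    have [u [Fu /asboolP[su _] /asboolP[tu _]]] := two _ _ Fs Ft.
    by exists u; split; [|exact: su|exact: tu].
  have sqC : square_inj C g.
    split.
    - have [[e0 [e1 [B0e B1e e01]]] _ _] := svalP t0.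
      by exists e0, e1; split=> //; exists t0.
    - move=> a b Ca Cb; have [t [Ft ta tb]] := pair _ _ Ca Cb.
      rewrite (gE t)//; exists t => //; have [_ tf _] := svalP t; exact: tf.
    - move=> a b c d Ca Cb Cc Cd.
      have [s [Fs sa sb]] := pair _ _ Ca Cb.
      have [t [Ft tc td]] := pair _ _ Cc Cd.
      have [u [Fu /asboolP[su _] /asboolP[tu _]]] := two _ _ Fs Ft.
      have [_ _ uI] := svalP u.
      by rewrite !(gE u); auto.
  exists (exist _ (C, g) sqC) => s Fs; apply/asboolP; split=> /=.
    by move=> a sa; exists s.
  by move=> a b sa sb; rewrite (gE s).
exists B, f; split=> // C g sqC BC fg.
have /asboolP[] // : R (exist _ (C, g) sqC) (exist _ (B, f) sq).
by apply: Bmax; apply/asboolP; split.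
Qed.

(* For a maximal [B]: either [A] embeds into two copies of [B], hence into [B],
   or [A] contains a copy [h @` B] of [B] disjoint from [B], and sending the new
   pairs into that copy extends [f] to [B `|` h @` B]. *)
Lemma card_square : infinite_set [set: A] -> [set: A * A] #<= [set: A].
Proof.
move=> /square_inj_maximal[B [f [[[e0 [e1 [Be0 Be1 e01]]] fB fI] Bmax]]].
(* The tag [t] tells whether an element lies in [B]; [b] fixes [B] and applies [r] elsewhere. *)
have coding (D : set A) (r : A -> A) :
    (forall a, D a -> ~ B a -> B (r a)) ->
    (forall a c, D a -> D c -> ~ B a -> ~ B c -> r a = r c -> a = c) ->
  exists t b : A -> A, [/\ forall a, B (t a), forall a, D a -> B (b a) &
    forall a c, D a -> D c -> t a = t c -> b a = b c -> a = c].
  move=> rB rI.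
  exists (fun a => if pselect (B a) then e0 else e1).
  exists (fun a => if pselect (B a) then a else r a).
  split=> [a|a Da|a c Da Dc]; [by case: pselect|by case: pselect => Ba /=; auto|].
  case: pselect => Ba; case: pselect => Bc //; last by auto.
  by move=> /esym.
have [/(card_le_fun _ _ e0)[r rI rB]|/(card_le_fun _ _ e0)[h hI hB]] :=
    card_le_total (~` B) B.
  have [||t [b [tB bB tbI]]] := coding setT r; [by auto..|].
  have {}bB a := bB a I; have {}tbI a c := tbI a c I I.
  have AB : [set: A] #<= B.
    apply/card_leTP; exists (fun a => f (t a) (b a)) => [a c|a]; last by auto.
    by move=> /fI[]//; auto.
  apply: card_le_trans (card_leT B).
  have /card_leTP[g gI gB] := AB; apply/card_leTP.
  exists (fun p => f (g p.1) (g p.2)) => [[a c] [a' c'] /fI[]//|p]; last by auto.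
  by move=> /gI /= -> /gI /= ->.
pose r a := if pselect (exists2 b, B b & h b = a) is left e
  then s2val (cid2 e) else e0.
have rK a : B a -> r (h a) = a.
  move=> Ba; rewrite /r; case: pselect => [e|[]]; last by exists a.
  by case: (cid2 e) => c Bc /= /hI; apply.
pose D := B `|` h @` B.
have [||t [b [tB bB tbI]]] := coding D r.
- by move=> a [//|[c Bc <-]] _; rewrite rK.
- by move=> a c [//|[x Bx <-]] [//|[y By <-]] _ _; rewrite !rK// => ->.
pose code x y := f (f (t x) (t y)) (f (b x) (b y)).
have tfB x y : B (f (t x) (t y)) by exact: fB.
have bfB x y : D x -> D y -> B (f (b x) (b y)) by move=> Dx Dy; apply: fB; auto.
have codeB x y : D x -> D y -> B (code x y) by move=> Dx Dy; apply: fB; auto.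
have codeI x y z w : D x -> D y -> D z -> D w -> code x y = code z w ->
    x = z /\ y = w.
  move=> Dx Dy Dz Dw /fI[]; auto.
  by move=> /fI[]; auto => tx ty /fI[]; auto.
pose g x y := if pselect (B x /\ B y) then f x y else h (code x y).
have DB : D `<=` B.
  apply: (Bmax D g); last 2 first.
  - by move=> a Ba; left.
  - by move=> x y Bx By; rewrite /g; case: pselect => // -[].
  split.
  - by exists e0, e1; split=> //; left.
  - move=> x y Dx Dy; rewrite /g; case: pselect => [[Bx By]|?].
      by left; exact: fB.
    by right; exists (code x y); auto.
  - move=> x y z w Dx Dy Dz Dw; rewrite /g.
    case: pselect => [[Bx By]|?]; case: pselect => [[Bz Bw]|?].
    + exact: fI.
    (* The mixed cases are impossible: [f] maps pairs from [B] into [B], while [h] maps [B] outside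
       [B]. *)
    + by move=> /= E; case: (hB _ (codeB z w Dz Dw)); rewrite -E; exact: fB.
    + by move=> /= E; case: (hB _ (codeB x y Dx Dy)); rewrite E; exact: fB.
    + by move=> /= /hI cE; apply: codeI; auto.
by case: (hB e0 Be0); apply: DB; right; exists e0.
Qed.

End Square.

(** * Regular open sets and pinning sets *)

Lemma regopen_open (X : topologicalType) (U : set X) : regopen U -> open U.
Proof. by move=> <-; exact: open_interior. Qed.

(** An open set inside [closure V] lies in the interior of [closure V], which is [V] by
    regularity. *)
Lemma regopen_subset (X : topologicalType) (U V : set X) :
  regopen U -> regopen V -> U `\` closure V = set0 -> U `<=` V.
Proof.
move=> Ur Vr; rewrite setD_eq0 => UV; rewrite -Vr.
by rewrite -open_subsetE //; exact: regopen_open.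
Qed.

Theorem corollary2p8 (L K : Type) (X : topologicalType) :
  infinite_set [set: L] ->
  is_succ_card [set: K] [set: set L] ->
  pinning_down_pair X [set: K] [set: L] ->
  RO X #<= [set: set L] /\
  (pi_base (ROplus X) -> density X #<= [set: L]).
Proof.
move=> /infiniteP nL [[LK nKL] Kmin] pin.
have Koo : infinite_set [set: K].
  apply/infiniteP; apply: card_le_trans LK; apply: card_le_trans nL _.
  by apply/card_leTP; exists set1 => // x y /seteqP[/(_ x erefl)].
have ROL : RO X #<= [set: set L].
  have [//|LRO] := card_le_total (RO X) [set: set L].
  (* If the bound fails, minimality of the successor cardinal gives distinct regular open sets [k a]
     indexed by [K]. *)
  apply: contrapT => nRO; have /card_leTP[k kI kRO] := Kmin _ _ (conj LRO nRO).
  pose D (p : K * K) := k p.1 `\` closure (k p.2).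
  have [||B [/card_lePT[j jI] BD]] := pin [set U | range D U /\ U !=set0].
  - move=> _ [[p _ <-] D0]; split=> //; apply: openI.
      exact/regopen_open/kRO.
    exact/closed_openC/closed_closure.
  - apply: card_le_trans (card_le_trans (card_image_le D setT) (card_square _ Koo)).
    by apply: subset_card_le => U [].
  (* Through [j], the trace of [k a] on [B] becomes a subset of [L]. *)
  apply: nKL; apply/card_leTP.
  exists (fun a => [set j x | x in [set x | k a (val x)]]) => // a b.
  have sub c d : [set j x | x in [set x : B | k c (val x)]] `<=`
                 [set j x | x in [set x : B | k d (val x)]] -> k c `<=` k d.
    move=> cd; apply: regopen_subset; try exact: kRO.
    apply: contrapT => /eqP/set0P D0.
    have [|x [Bx [cx ndx]]] := BD (D (c, d)); first by split.
    apply: ndx; apply: subset_closure.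
    have [|y dy /jI yx] := cd (j (SigSub (mem_set Bx))).
      by exists (SigSub (mem_set Bx)).
    by move: dy; rewrite yx.
  by move=> /seteqP[ab ba]; apply: kI; apply/seteqP; split; exact: sub.
split=> // -[ROo ROb].
(* By the bound just proved, [ROplus X] is small enough to be pinned down, and a set meeting every
   member of a pi-base is dense. *)
have [||B [BL BRO]] := pin (ROplus X).
- exact: ROo.
- apply: card_le_trans LK; apply: card_le_trans ROL; apply: subset_card_le.
  by move=> U [].
apply: card_le_trans BL; have [_] := densityP X; apply => O O0 Oo.
have [U /BRO[x [Bx Ux]] UO] := ROb _ Oo O0.
by exists x; split=> //; exact: UO.
Qed.
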